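(* Every nonempty DSF set contains a complete bipartite graph (possibly with an empty part) and a disjoint union of complete graphs in which at most one component has more than two vertices. Moreover, every nonempty DSF set also contains a disjoint union of at most two complete graphs and a complete multipartite graph in which at most one partite set has more than two vertices.
   Context: All graphs are finite and simple, considered up to isomorphism. For a set $\mathcal{F}$ of graphs, a graph is $\mathcal{F}$-free if none of its induced subgraphs is isomorphic to a member of $\mathcal{F}$. A set $\mathcal{F}$ of graphs is degree-sequence-forcing (DSF) if whenever some realization of a degree sequence $d$ (a graph with degree sequence $d$) is $\mathcal{F}$-free, every realization of $d$ is $\mathcal{F}$-free. ''Contains'' here means ''has as an element''. *)

(* Defs.v *)
From HB Require Import structures.
From mathcomp Require Import all_boot.

Set Implicit Arguments.
Unset Strict Implicit.
Unset Printing Implicit Defensive.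

(* The graph with no vertices is allowed. *)
Record sgraph := SGraph {
  vertex :> finType;
  adj : rel vertex;
  adj_sym : symmetric adj;
  adj_irrefl : irreflexive adj
}.

Definition iso (G H : sgraph) : Prop :=
  exists f : G -> H, bijective f /\ forall x y, adj (f x) (f y) = adj x y.

Section Induced.
Variables (G : sgraph) (S : {set G}).

Definition induced_adj : rel {x : G | x \in S} :=
  [rel x y | adj (val x) (val y)].

Lemma induced_adj_sym : symmetric induced_adj.
Proof. by move=> x y; exact: adj_sym. Qed.

Lemma induced_adj_irrefl : irreflexive induced_adj.
Proof. by move=> x; exact: adj_irrefl. Qed.

Definition induced : sgraph := SGraph induced_adj_sym induced_adj_irrefl.
End Induced.

(* A set of graphs is an arbitrary predicate on sgraph, not necessarily closed
   under isomorphism: it is only ever tested up to isomorphism below. *)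
Definition free (F : sgraph -> Prop) (G : sgraph) : Prop :=
  forall (S : {set G}) (H : sgraph), F H -> ~ iso (induced S) H.

Definition deg (G : sgraph) (x : G) : nat := #|[set y | adj x y]|.

Definition degree_sequence (G : sgraph) : seq nat :=
  sort geq [seq deg x | x <- enum G].

Definition realization (d : seq nat) (G : sgraph) : Prop :=
  degree_sequence G = d.

Definition DSF (F : sgraph -> Prop) : Prop :=
  forall d : seq nat,
    (exists G, realization d G /\ free F G) ->
    forall G, realization d G -> free F G.

(* The parts are A and its complement; either may be empty. *)
Definition complete_bipartite (G : sgraph) : Prop :=
  exists A : {set G}, forall x y : G, adj x y = ((x \in A) != (y \in A)).

(* The blocks of P, nonempty by definition of partition, are the vertex sets of
   the complete graphs, i.e. the components of G. *)
Definition complete_union (G : sgraph) (P : {set {set G}}) : Prop :=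
  partition P [set: G] /\
  forall x y : G, adj x y = (x != y) && (pblock P x == pblock P y).

Definition complete_multipartite (G : sgraph) (P : {set {set G}}) : Prop :=
  partition P [set: G] /\
  forall x y : G, adj x y = (pblock P x != pblock P y).

Definition at_most_one_large (T : finType) (P : {set {set T}}) : Prop :=
  #|[set B in P | 2 < #|B|]| <= 1.

(* Main.v *)
Require Import Defs.
From HB Require Import structures.
From mathcomp Require Import all_boot.
From Stdlib Require Import Classical.

Set Implicit Arguments.
Unset Strict Implicit.
Unset Printing Implicit Defensive.

(** If [H] and [H'] have the same degree sequence and [H] contains a member of
    a DSF set [F] as an induced subgraph, then so does [H'].  The four classes
    of the theorem are hereditary, so it suffices to embed an arbitrary graph
    [G] as an induced subgraph of a graph [H] with the same degree sequence as
    a member [H'] of the class.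

    For complete bipartite graphs, [H] consists of two copies of [G], with
    vertices of different copies adjacent when they are not adjacent in [G];
    it is [n]-regular on [2n] vertices, like [K_{n,n}].  For disjoint unions of
    complete graphs, [H] is [G] with a pendant vertex attached to [u] for each
    ordered nonadjacent pair [(u, v)]; it has the degrees of the graph in
    which [G] is completed and the pendant vertices of [(u, v)] and [(v, u)]
    are matched.  The other two classes are obtained by complementation. *)

(** * Embeddings and transfer along equal degrees *)

Definition embedding (G H : sgraph) (f : G -> H) : Prop :=
  injective f /\ forall x y, adj (f x) (f y) = adj x y.

Lemma embedding_induced (G H : sgraph) (f : G -> H) :
  embedding f -> iso (induced [set f x | x in G]) G.
Proof.
move=> [f_inj f_adj].
have fP x : f x \in [set f x | x in G] by exact: imset_f.
pose g (x : G) : induced [set f x | x in G] := exist _ (f x) (fP x).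
have g_bij : bijective g.
  apply: inj_card_bij => [x y [] /f_inj //|].
  by rewrite card_sig card_imset.
have [h gK hK] := g_bij.
exists h; split; first by exists g.
by move=> x y; rewrite -f_adj -{2}[x]hK -{2}[y]hK.
Qed.

Lemma iso_induced_embedding (G H : sgraph) (S : {set H}) :
  iso (induced S) G -> exists f : G -> H, embedding f.
Proof.
move=> [f [[g fK gK] f_adj]]; exists (val \o g); split.
  by apply: inj_comp; [exact: val_inj | exact: can_inj gK].
by move=> x y; rewrite -[in RHS](gK x) -[in RHS](gK y) f_adj.
Qed.

Definition degree_bijection (H H' : sgraph) (h : H -> H') : Prop :=
  bijective h /\ forall x, deg (h x) = deg x.

Lemma degree_bijection_degree_sequence (H H' : sgraph) (h : H -> H') :
  degree_bijection h -> degree_sequence H = degree_sequence H'.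
Proof.
move=> [h_bij h_deg]; apply/perm_sortP.
- by move=> m n; exact: leq_total.
- by move=> m n p le_mn le_pm; exact: leq_trans le_pm le_mn.
- by move=> m n; rewrite andbC => /anti_leq.
have -> : [seq deg x | x <- enum H] = [seq deg x | x <- [seq h x | x <- enum H]].
  by rewrite -map_comp; apply: eq_map => x /=; rewrite h_deg.
apply/perm_map/uniq_perm.
- by rewrite map_inj_uniq ?enum_uniq //; exact: bij_inj.
- exact: enum_uniq.
move=> y; have [g _ gK] := h_bij.
by rewrite mem_enum -[y]gK map_f // mem_enum.
Qed.

(** If no member of [F] embedded in [H'], then [H'] would be [F]-free, hence so would [H], which
    contains [G]. *)
Lemma DSF_transfer (F : sgraph -> Prop) (G H H' : sgraph)
    (f : G -> H) (h : H -> H') :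
  DSF F -> F G -> embedding f -> degree_bijection h ->
  exists K, F K /\ exists g : K -> H', embedding g.
Proof.
move=> dsfF FG f_emb h_deg; apply: NNPP => noK.
suff /(_ _ G FG (embedding_induced f_emb)) : free F H by [].
apply: (dsfF (degree_sequence H)) => //; exists H'; split.
  exact/esym/degree_bijection_degree_sequence/h_deg.
by move=> S K FK /iso_induced_embedding[g g_emb]; apply: noK; exists K; eauto.
Qed.

(** * Complements *)

Section Complement.
Variable G : sgraph.

Definition compl_adj (x y : G) : bool := (x != y) && ~~ adj x y.
Arguments compl_adj _ _ /.

Lemma compl_adj_sym : symmetric compl_adj.
Proof. by move=> x y /=; rewrite eq_sym adj_sym. Qed.

Lemma compl_adj_irrefl : irreflexive compl_adj.
Proof. by move=> x /=; rewrite eqxx. Qed.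

Definition compl : sgraph := SGraph compl_adj_sym compl_adj_irrefl.

Lemma deg_compl (x : G) : @deg compl x = #|G| - (deg x).+1.
Proof.
rewrite /deg [LHS]cardsCs; congr (_ - _).
rewrite (_ : ~: _ = x |: [set y | adj x y]); last first.
  by apply/setP => y; rewrite !inE /= negb_and !negbK [y == x]eq_sym.
by rewrite cardsU1 inE adj_irrefl.
Qed.
End Complement.
Arguments compl_adj _ _ _ /.

(** The complement sits on the source, so [G] itself embeds in [compl H] and [compl (compl G)] never
    arises. *)
Lemma embedding_compl (G H : sgraph) (f : compl G -> H) :
  embedding f -> @embedding G (compl H) f.
Proof.
move=> [f_inj f_adj]; split=> // x y /=.
rewrite f_adj /= (inj_eq f_inj).
by case: eqVneq => [->|_] /=; rewrite ?adj_irrefl ?negbK.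
Qed.

Lemma degree_bijection_compl (H H' : sgraph) (h : H -> H') :
  degree_bijection h -> @degree_bijection (compl H) (compl H') h.
Proof.
move=> [h_bij h_deg]; split=> // x.
by rewrite !deg_compl h_deg (bij_eq_card h_bij).
Qed.

(** * Labellings and the partitions they induce *)

Definition union_labelling (G : sgraph) (L : eqType) (c : G -> L) : Prop :=
  forall x y, adj x y = (x != y) && (c x == c y).

Definition multipartite_labelling (G : sgraph) (L : eqType) (c : G -> L) :
  Prop := forall x y, adj x y = (c x != c y).

Lemma multipartite_labelling_compl (G : sgraph) (L : eqType) (c : G -> L) :
  union_labelling c -> @multipartite_labelling (compl G) L c.
Proof.
move=> c_adj x y /=; rewrite c_adj.
by case: eqVneq => [->|_] //=; rewrite eqxx.
Qed.

Lemma union_labelling_compl (G : sgraph) (L : eqType) (c : G -> L) :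
  multipartite_labelling c -> @union_labelling (compl G) L c.
Proof. by move=> c_adj x y /=; rewrite c_adj negbK. Qed.

Lemma union_labelling_embedding (G H : sgraph) (L : eqType) (c : H -> L)
    (f : G -> H) :
  union_labelling c -> embedding f -> union_labelling (c \o f).
Proof.
by move=> c_adj [f_inj f_adj] x y; rewrite -f_adj c_adj (inj_eq f_inj).
Qed.

Lemma multipartite_labelling_embedding (G H : sgraph) (L : eqType)
    (c : H -> L) (f : G -> H) :
  multipartite_labelling c -> embedding f -> multipartite_labelling (c \o f).
Proof. by move=> c_adj [f_inj f_adj] x y; rewrite -f_adj c_adj. Qed.

Section LabelPartition.
Variables (T : finType) (L : eqType) (c : T -> L).

(** Partitions appear only at the end: labellings pull back along embeddings by mere composition,
    with no empty blocks to discard. *)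
Definition label_partition : {set {set T}} := preim_partition c [set: T].

Lemma pblock_label_partition (x y : T) :
  (pblock label_partition x == pblock label_partition y) = (c x == c y).
Proof.
have /and3P[/eqP covP tiP _] : partition label_partition [set: T].
  exact: preim_partitionP.
rewrite eq_pblock ?covP // pblock_equivalence_partition //.
by move=> u v w _ _ _; split=> // /eqP->.
Qed.

Lemma mem_label_partition (B : {set T}) :
  B \in label_partition -> exists x, B = [set y | c x == c y].
Proof.
by move=> /imsetP[x _ ->]; exists x; apply/setP => y; rewrite !inE.
Qed.
End LabelPartition.

Lemma union_labellingP (G : sgraph) (L : eqType) (c : G -> L) :
  union_labelling c -> complete_union (label_partition c).
Proof.
move=> c_adj; split; first exact: preim_partitionP.
by move=> x y; rewrite pblock_label_partition c_adj.
Qed.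

Lemma multipartite_labellingP (G : sgraph) (L : eqType) (c : G -> L) :
  multipartite_labelling c -> complete_multipartite (label_partition c).
Proof.
move=> c_adj; split; first exact: preim_partitionP.
by move=> x y; rewrite pblock_label_partition c_adj.
Qed.

Lemma card_label_partition_bool (T : finType) (c : T -> bool) :
  #|label_partition c| <= 2.
Proof.
apply: (@leq_trans #|[set [set y | b == c y] | b : bool]|).
  apply/subset_leq_card/subsetP => B /mem_label_partition[x ->].
  by apply/imsetP; exists (c x).
by apply: leq_trans (leq_imset_card _ _) _; rewrite card_bool.
Qed.

(** Only the class of [None] can be large. *)
Lemma at_most_one_large_label (T : finType) (L : eqType) (c : T -> option L) :
  (forall l, #|[set y | c y == Some l]| <= 2) ->
  at_most_one_large (label_partition c).
Proof.
move=> small; apply: (@leq_trans #|[set [set y | c y == None]]|); last first.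
  by rewrite cards1.
apply/subset_leq_card/subsetP => B; rewrite !inE => /andP[].
move=> /mem_label_partition[x ->].
case: (c x) => [l|] large; last by apply/eqP/setP => y; rewrite !inE eq_sym.
have := small l; rewrite leqNgt => /negP[]; apply: leq_trans large _.
by apply/subset_leq_card/subsetP => y; rewrite !inE eq_sym.
Qed.

(** * Degree sums *)

Lemma deg_sum (G : sgraph) (x : G) : deg x = \sum_(y : G) adj x y.
Proof.
by rewrite /deg -sum1dep_card big_mkcond; apply: eq_bigr => y _; case: adj.
Qed.

Lemma sum_eq_and (T : finType) (a : T) (b : bool) :
  \sum_(y : T) (y == a) && b = b.
Proof.
rewrite (bigD1 a) //= eqxx big1 ?addn0 // => y /negPf->.
by [].
Qed.

(** * Two copies of a graph against a balanced biclique *)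

Section Double.
Variable G : sgraph.

(** As [adj] is irreflexive, the two copies of one vertex are adjacent. *)
Definition double_adj (x y : G * bool) : bool :=
  (x.2 == y.2) == adj x.1 y.1.
Arguments double_adj _ _ /.

Lemma double_adj_sym : symmetric double_adj.
Proof. by move=> x y /=; rewrite adj_sym [x.2 == _]eq_sym. Qed.

Lemma double_adj_irrefl : irreflexive double_adj.
Proof. by move=> x /=; rewrite adj_irrefl eqxx. Qed.

Definition double : sgraph := SGraph double_adj_sym double_adj_irrefl.

Definition biclique_adj (x y : G * bool) : bool := x.2 != y.2.
Arguments biclique_adj _ _ /.

Lemma biclique_adj_sym : symmetric biclique_adj.
Proof. by move=> x y /=; rewrite eq_sym. Qed.

Lemma biclique_adj_irrefl : irreflexive biclique_adj.
Proof. by move=> x /=; rewrite eqxx. Qed.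

Definition biclique : sgraph := SGraph biclique_adj_sym biclique_adj_irrefl.

Lemma double_embedding : @embedding G double (fun x => (x, false)).
Proof. by split=> [x y [] | x y /=]. Qed.

Lemma double_degree_bijection : @degree_bijection double biclique id.
Proof.
split; first by exists id.
move=> [u i]; rewrite !deg_sum.
have sumE (E : G -> bool -> bool) :
    \sum_(y : G * bool) E y.1 y.2 = \sum_v \sum_j E v j by rewrite pair_bigA.
rewrite [LHS](sumE (fun v j => i != j)).
rewrite [RHS](sumE (fun v j => (i == j) == adj u v)).
(* In either graph exactly one of the two copies of [v] is adjacent to [(u, i)]. *)
apply: eq_bigr => v _; rewrite !big_bool /=.
by case: i; case: adj.
Qed.

Lemma biclique_labelling : @multipartite_labelling biclique bool snd.
Proof. by []. Qed.
End Double.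

(** * Pendant vertices against a clique with a matching *)

Section Pendant.
Variable G : sgraph.

(* Only the [inr (u, v)] with [u] and [v] distinct and nonadjacent play the
   role of pendant vertices; the others are isolated. *)
Definition pendant_adj : rel (G + G * G) := fun x y =>
  match x, y with
  | inl u, inl v => adj u v
  | inl u, inr p => (p.1 == u) && @adj (compl G) p.1 p.2
  | inr p, inl u => (p.1 == u) && @adj (compl G) p.1 p.2
  | inr _, inr _ => false
  end.

Lemma pendant_adj_sym : symmetric pendant_adj.
Proof. by move=> [u|p] [v|q] //=; rewrite adj_sym. Qed.

Lemma pendant_adj_irrefl : irreflexive pendant_adj.
Proof. by move=> [u|p] //=; rewrite adj_irrefl. Qed.

Definition pendant : sgraph := SGraph pendant_adj_sym pendant_adj_irrefl.

(** Pairs that are not pendant vertices stay isolated here too, so the identity preserves all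
    degrees. *)
Definition matched_adj : rel (G + G * G) := fun x y =>
  match x, y with
  | inl u, inl v => u != v
  | inr p, inr q => (q == (p.2, p.1)) && @adj (compl G) p.1 p.2
  | _, _ => false
  end.

Lemma matched_adj_sym : symmetric matched_adj.
Proof.
move=> [u|[a b]] [v|[a' b']] //=; first by rewrite eq_sym.
rewrite !xpair_eqE [a == b']eq_sym [b == a']eq_sym [X in _ = X && _]andbC.
case: eqVneq => [->|_] //=; case: eqVneq => [->|_] //=.
by rewrite eq_sym adj_sym.
Qed.

Lemma matched_adj_irrefl : irreflexive matched_adj.
Proof.
move=> [u|[a b]] /=; first by rewrite eqxx.
by rewrite xpair_eqE; case: (eqVneq a b); rewrite /= ?andbF.
Qed.

Definition matched : sgraph := SGraph matched_adj_sym matched_adj_irrefl.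

Lemma pendant_embedding : @embedding G pendant inl.
Proof. by split=> [x y []|]. Qed.

Lemma pendant_degree_bijection : @degree_bijection pendant matched id.
Proof.
split; first by exists id.
move=> [u|[a b]]; rewrite !deg_sum !big_sumType /=.
  rewrite (big1 _ _ (fun i : G * G => _)) // addn0.
  (* Summing over the second coordinate [v] first pairs the edge [u v] with the pendant vertex
     [(u, v)]: exactly one of them is present when [u != v], and neither when [u = v]. *)
  rewrite -(pair_bigA _
    (fun a b => nat_of_bool ((a == u) && ((a != b) && ~~ adj a b)))) /=.
  rewrite exchange_big -big_split /=; apply: eq_bigr => v _.
  rewrite (eq_bigr (fun i => nat_of_bool ((i == u) && ((u != v) && ~~ adj u v)))).
    rewrite sum_eq_and; case: eqVneq => [->|_]; first by rewrite adj_irrefl.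
    by case: adj.
  by move=> i _; case: eqVneq => [->|].
(* The only possible neighbour of [(a, b)] is [(b, a)] in [matched] and [a] in [pendant], under the
   same condition. *)
rewrite sum_eq_and [X in X + _]big1 // [X in _ = _ + X]big1 // add0n addn0.
rewrite -[LHS](sum_eq_and a); apply: eq_bigr => v _.
by rewrite [v == a]eq_sym.
Qed.

(** [None] names the clique on [G]; any other component is named by its own vertex set, so both ends
    of a matched edge get the same label. *)
Definition matched_label (x : G + G * G) : option {set G * G} :=
  match x with
  | inl _ => None
  | inr p => Some (if @adj (compl G) p.1 p.2 then [set p; (p.2, p.1)]
                   else [set p])
  end.

Lemma mem_matched_label (p : G * G) (l : {set G * G}) :
  matched_label (inr p) = Some l -> p \in l.
Proof. by case=> <-; case: ifP => _; rewrite !inE eqxx. Qed.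

Lemma matched_labelling : @union_labelling matched _ matched_label.
Proof.
move=> [u|p] [v|q] //; first by rewrite /= eqxx andbT.
apply/idP/idP => [pq|/andP[neq_pq /eqP eq_label]].
  have neq_pq : (inr p : matched) != inr q.
    by apply: contraTneq pq => <-; rewrite adj_irrefl.
  rewrite neq_pq; move: pq => /andP[/eqP-> adj_p].
  have adj_q : @adj (compl G) (p.2, p.1).1 (p.2, p.1).2 by rewrite adj_sym.
  by rewrite /matched_label adj_p adj_q setUC -surjective_pairing eqxx.
(* Now [q] lies in the label of [p]; being distinct from [p], it must be the matched partner. *)
have := mem_matched_label (esym eq_label).
have {neq_pq} /negPf neq_qp : q != p by apply: contraNneq neq_pq => ->.
case: ifP => adj_p; rewrite !inE neq_qp //= => eq_q.
exact/andP.
Qed.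

Lemma matched_label_card (l : {set G * G}) :
  #|[set y | matched_label y == Some l]| <= 2.
Proof.
(* An arbitrary [l] may be large, but then its class is empty; a label in use has at most two
   elements and contains its class. *)
have [->|[y]] := set_0Vmem [set y | matched_label y == Some l].
  by rewrite cards0.
rewrite inE => y_l; apply: (@leq_trans #|l|).
  rewrite -(card_imset (mem l) (@inr_inj G (G * G))).
  apply/subset_leq_card/subsetP => -[u|p]; rewrite inE // => /eqP p_l.
  by apply/imset_f/mem_matched_label.
case: y y_l => [u|p] //= /eqP[<-].
by case: ifP => _; rewrite ?cards1 // cards2; case: (_ != _).
Qed.
End Pendant.

(** * The four classes *)

Lemma matched_label_partition_large (G : sgraph) (T : finType)
    (f : T -> G + G * G) :
  injective f -> at_most_one_large (label_partition (@matched_label G \o f)).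
Proof.
move=> f_inj; apply: at_most_one_large_label => l.
apply: leq_trans (matched_label_card l); rewrite -(card_imset _ f_inj).
apply/subset_leq_card/subsetP => y /imsetP[x].
by rewrite !inE => x_l ->.
Qed.

Theorem theorem3p2 (F : sgraph -> Prop) (F_nonempty : exists G : sgraph, F G)
    (F_DSF : DSF F) :
  ((exists G : sgraph, F G /\ complete_bipartite G) /\
   (exists G : sgraph, F G /\
      exists P : {set {set G}}, complete_union P /\ at_most_one_large P)) /\
  ((exists G : sgraph, F G /\
      exists P : {set {set G}}, complete_union P /\ #|P| <= 2) /\
   (exists G : sgraph, F G /\
      exists P : {set {set G}},
        complete_multipartite P /\ at_most_one_large P)).
Proof.
have [G FG] := F_nonempty.
split; split.
- have [K [FK [g g_emb]]] := DSF_transfer F_DSF FG (double_embedding G)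
    (double_degree_bijection G).
  have gP := multipartite_labelling_embedding (@biclique_labelling G) g_emb.
  exists K; split=> //; exists [set x | (snd \o g) x] => x y.
  by rewrite !inE gP.
- have [K [FK [g g_emb]]] := DSF_transfer F_DSF FG (pendant_embedding G)
    (pendant_degree_bijection G).
  have gP := union_labelling_embedding (@matched_labelling G) g_emb.
  exists K; split=> //; exists (label_partition (@matched_label G \o g)).
  split; first exact: union_labellingP.
  by apply: matched_label_partition_large; case: g_emb.
(* The construction is applied to [compl G] and both graphs are complemented; the biclique becomes
   two disjoint cliques. *)
- have [K [FK [g g_emb]]] := DSF_transfer F_DSF FG
    (embedding_compl (double_embedding (compl G)))
    (degree_bijection_compl (double_degree_bijection (compl G))).
  have gP := union_labelling_embedding
    (union_labelling_compl (@biclique_labelling (compl G))) g_emb.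
  exists K; split=> //; exists (label_partition (snd \o g)).
  by split; [exact: union_labellingP | exact: card_label_partition_bool].
- have [K [FK [g g_emb]]] := DSF_transfer F_DSF FG
    (embedding_compl (pendant_embedding (compl G)))
    (degree_bijection_compl (pendant_degree_bijection (compl G))).
  have gP := multipartite_labelling_embedding
    (multipartite_labelling_compl (@matched_labelling (compl G))) g_emb.
  exists K; split=> //; exists (label_partition (@matched_label (compl G) \o g)).
  split; first exact: multipartite_labellingP.
  by apply: matched_label_partition_large; case: g_emb.
Qed.
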